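(* Let $B$ be a domain, $M$ a maximal ideal of $B$, $\pi:B\to B/M$ the canonical map, and $K$ a proper subfield of $B/M$. Then the pullback domain $A=\pi^{-1}(K)$ is not perinormal.
   Context: All rings are commutative unitary integral domains. An overring of a domain $A$ is a ring $C$ between $A$ and the quotient field of $A$. An overring $C$ of $A$ is a going down overring if going down holds for $A\subseteq C$, that is, for each $Q\in\mathrm{Spec}(C)$ the induced map $\mathrm{Spec}(C_Q)\to\mathrm{Spec}(A_{Q\cap A})$ is surjective. $A$ is perinormal if every going down overring of $A$ is flat as an $A$-module.
   Formalization: The maximal ideal M is assumed nonzero (B is not a field); if M = 0 then A is isomorphic to the field K, whose only overring is itself, so A is perinormal and the claim fails. *)

(* Defs.v *)
From HB Require Import structures.
From mathcomp Require Import all_boot all_algebra.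
From mathcomp Require Import boolp classical_sets functions.

Set Implicit Arguments.
Unset Strict Implicit.
Unset Printing Implicit Defensive.

Import GRing.Theory.
Local Open Scope ring_scope.
Local Open Scope quotient_scope.
Local Open Scope classical_set_scope.

HB.mixin Record isMaximalIdealr (R : nzRingType) (S : R -> bool) := {
  maximal_idealr_subproof : forall J : {pred R},
    idealr_closed J -> {subset S <= J} -> {subset J <= S}
}.

#[short(type="maximal_idealr")]
HB.structure Definition MaximalIdealr (R : nzRingType) :=
  {S of Idealr R S & isMaximalIdealr R S}.

(* The unit and inverse structure on R / M comes from maximality of M, so that
   divringClosed subsets of R / M are exactly its subfields. *)
Section ResidueField.
Variables (R : comNzRingType) (M : maximal_idealr R).
Local Notation k := {ideal_quot M}.

Lemma residue_inv_ex (x : k) : x != 0 -> exists y : k, y * x == 1.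
Proof.
rewrite -[x]reprK; set r := repr x => rN0.
have rM : r \notin M.
  apply: contraNN rN0 => rM.
  by rewrite piE /Quotient.equiv subr0.
pose J : {pred R} := [pred z | `[< exists2 m, m \in M & exists a, z = m + a * r >] ].
have MJ : {subset M <= J}.
  by move=> m mM; apply/asboolP; exists m => //; exists 0; rewrite mul0r addr0.
have rJ : r \in J.
  by apply/asboolP; exists 0; [exact: rpred0 | exists 1; rewrite mul1r add0r].
have J1 : 1 \in J.
  apply: contraNT rM => J1; apply: (maximal_idealr_subproof J) => //.
  split=> // [|a u v /asboolP[m mM [b ->]] /asboolP[n nM [c ->]]].
    exact/MJ/rpred0.
  apply/asboolP; exists (a * m + n); first by rewrite rpredD // idealMr.
  by exists (a * b + c); rewrite mulrDr mulrDl addrACA !mulrA.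
move/asboolP: J1 => [m mM [a e]]; exists (\pi_k a).
apply/eqP; rewrite -rmorphM -(rmorph1 \pi_k); apply/eqP.
by rewrite piE /Quotient.equiv e opprD addrCA subrr addr0 rpredN.
Qed.

Definition residue_inv (x : k) : k :=
  if pselect (x != 0) is left xN0 then xchoose (residue_inv_ex xN0) else 0.

Lemma residue_mulVf (x : k) : x != 0 -> residue_inv x * x = 1.
Proof.
rewrite /residue_inv => xN0; case: pselect => // h.
exact/eqP/(xchooseP (residue_inv_ex h)).
Qed.

Lemma residue_inv0 : residue_inv 0 = 0.
Proof. by rewrite /residue_inv; case: pselect => // h; have := h; rewrite eqxx. Qed.

HB.instance Definition _ :=
  GRing.ComNzRing_isField.Build k residue_mulVf residue_inv0.

End ResidueField.

Section Pullback.
Variables (B : idomainType) (M : maximal_idealr B).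
Variable K : divringClosed {ideal_quot M}.

Definition pullback_pred : {pred B} := [pred b | \pi_({ideal_quot M}) b \in K].

(* K contains the inverses of its nonzero elements, hence the pullback contains
   the inverses in B of its elements that are units of B; this is what makes it
   an idomainType with the unit predicate inherited from B. *)
Lemma pullback_divring_closed : divring_closed pullback_pred.
Proof.
split=> [|x y xK yK|x y xK yK]; rewrite inE.
- by rewrite rmorph1 rpred1.
- by rewrite rmorphB rpredB.
have [yU|yU] := boolP (y \is a GRing.unit).
  by rewrite rmorphM rmorphV // rpredM // rpredV.
by rewrite invr_out // rmorphM rpredM.
Qed.

HB.instance Definition _ :=
  GRing.isDivringClosed.Build B pullback_pred pullback_divring_closed.

Definition pullback := {b : B | b \in pullback_pred}.

HB.instance Definition _ := [isSub of pullback for @sval _ _].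
HB.instance Definition _ := [Choice of pullback by <:].
HB.instance Definition _ := [SubChoice_isSubIntegralDomain of pullback by <:].

End Pullback.

(* All rings in this section are subrings of one field F, so the map on spectra
   induced by an inclusion of rings is intersection with the smaller ring, and
   the localization of C at a prime Q is a subring of F as well. *)

Section Subrings.
Variable F : fieldType.
Implicit Types C D P Q : set F.

Definition prime_ideal C Q : Prop :=
  [/\ Q `<=` C,
      [/\ Q 0, forall x y, Q x -> Q y -> Q (x + y)
             & forall c x, C c -> Q x -> Q (c * x)],
      ~ Q 1
    & forall x y, C x -> C y -> Q (x * y) -> Q x \/ Q y].

Definition Spec C : set (set F) := [set Q | prime_ideal C Q].

Definition loc C Q : set F :=
  [set x | exists c s, [/\ C c, C s, ~ Q s & x = c / s]].

Definition going_down D C : Prop :=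
  forall Q, Spec C Q ->
    set_surj (Spec (loc C Q)) (Spec (loc D (Q `&` D)))
             (fun P => P `&` loc D (Q `&` D)).

End Subrings.

(* The tensor product of N and C is the type of finite formal sums of pairs
   (n, c), read as the sum of the n (x) c, modulo tensor_eq; it is kept as a
   setoid. Additive inverses need no relation, since (- n, c) is inverse to
   (n, c) by tensor_Dl and tensor_0l. Tensoring is always right exact, so
   flatness of C is preservation of injectivity. *)

Section Flat.
Variable R : comNzRingType.

Inductive tensor_eq (N C : lmodType R) : seq (N * C) -> seq (N * C) -> Prop :=
| tensor_refl s : tensor_eq s s
| tensor_sym s t : tensor_eq s t -> tensor_eq t s
| tensor_trans s t u : tensor_eq s t -> tensor_eq t u -> tensor_eq s u
| tensor_cat s s' t t' :
    tensor_eq s s' -> tensor_eq t t' -> tensor_eq (s ++ t) (s' ++ t')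
| tensor_catC s t : tensor_eq (s ++ t) (t ++ s)
| tensor_0l c : tensor_eq [:: (0, c)] [::]
| tensor_Dl n n' c : tensor_eq [:: (n + n', c)] [:: (n, c); (n', c)]
| tensor_Dr n c c' : tensor_eq [:: (n, c + c')] [:: (n, c); (n, c')]
| tensor_Z a n c : tensor_eq [:: (a *: n, c)] [:: (n, a *: c)].

Definition tensor_map (N N' C : lmodType R) (f : N -> N') (s : seq (N * C)) :
  seq (N' * C) := [seq (f p.1, p.2) | p <- s].

Definition flat (C : lmodType R) : Prop :=
  forall (N N' : lmodType R) (f : {linear N -> N'}), injective f ->
  forall s t : seq (N * C),
    tensor_eq (tensor_map f s) (tensor_map f t) -> tensor_eq s t.

End Flat.

Section Perinormal.
Variable A : idomainType.
Local Notation "x %:F" := (@FracField.tofrac A x).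

Record overring := Overring {
  overring_set :> set {fraction A};
  overring_subring : subring_closed (mem overring_set);
  overring_incl : forall a : A, a%:F \in overring_set
}.

Section OverringModule.
Variable C : overring.

Definition overring_pred : {pred {fraction A}} := [pred x | x \in overring_set C].

HB.instance Definition _ :=
  GRing.isSubringClosed.Build {fraction A} overring_pred (overring_subring C).

Definition overring_mod := {x : {fraction A} | x \in overring_pred}.

HB.instance Definition _ := [isSub of overring_mod for @sval _ _].
HB.instance Definition _ := [Choice of overring_mod by <:].
HB.instance Definition _ := [SubChoice_isSubZmodule of overring_mod by <:].

Lemma overring_scale_subproof (a : A) (x : overring_mod) :
  a%:F * val x \in overring_pred.
Proof. by rewrite rpredM ?(valP x) // overring_incl. Qed.

Definition overring_scale (a : A) (x : overring_mod) : overring_mod :=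
  Sub (a%:F * val x) (overring_scale_subproof a x).

Lemma overring_scaleA a b x :
  overring_scale a (overring_scale b x) = overring_scale (a * b) x.
Proof. by apply: val_inj; rewrite !SubK rmorphM mulrA. Qed.

Lemma overring_scale1 : left_id 1 overring_scale.
Proof. by move=> x; apply: val_inj; rewrite SubK rmorph1 mul1r. Qed.

Lemma overring_scaleDr : right_distributive overring_scale +%R.
Proof. by move=> a x y; apply: val_inj; rewrite !(SubK, raddfD) /= mulrDr. Qed.

Lemma overring_scaleDl x : {morph overring_scale^~ x : a b / a + b}.
Proof. by move=> a b; apply: val_inj; rewrite !(SubK, raddfD) /= mulrDl. Qed.

HB.instance Definition _ := GRing.Zmodule_isLmodule.Build A overring_mod
  overring_scaleA overring_scale1 overring_scaleDr overring_scaleDl.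

End OverringModule.

Definition perinormal : Prop :=
  forall C : overring,
    going_down (range (@FracField.tofrac A)) C -> flat (overring_mod C).

End Perinormal.

(* Main.v *)
From HB Require Import structures.
Require Import Defs.
From mathcomp Require Import all_boot all_algebra.
From mathcomp Require Import boolp classical_sets functions.
From mathcomp Require Import ring.

Set Implicit Arguments.
Unset Strict Implicit.
Unset Printing Implicit Defensive.

Import GRing.Theory.
Local Open Scope ring_scope.
Local Open Scope quotient_scope.
Local Open Scope classical_set_scope.

(* [M] is a common ideal of [A] and [B], maximal in both, and some nonzero
   [m \in M] makes [B] an overring of [A] through [b |-> (b m) / m].

   Going down: multiplication by [M] sends [B_Q] into [A_q], where
   [q = Q `&` A].  A prime [P] of [A_q] not containing [M] is the contraction
   of [{y | M y `<=` P}]; one containing [M] is the contraction of [M B_Q].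

   Flatness: if an overring [C] is flat, [(A : x) C = C] for every [x \in C].
   For [x \in B] outside [A] the conductor [(A : x)] is [M], since [K] is a
   field, while [M B = M] is proper. *)

(** * Going down for two subrings of a field with a common maximal ideal *)

Section SharedMaximalIdeal.
Variables (F : fieldType) (C D I : set F).
Hypotheses (C_subring : subring_closed (mem C)) (D_subring : subring_closed (mem D)).
Hypotheses (DC : D `<=` C) (ID : I `<=` D).
Hypotheses (IB : forall x y, I x -> I y -> I (x - y))
           (IM : forall c x, C c -> I x -> I (c * x)).
Hypotheses (I_maxC : forall c, C c -> ~ I c -> exists2 t, C t & I (t * c - 1))
           (I_maxD : forall d, D d -> ~ I d -> exists2 t, D t & I (t * d - 1)).

Let C1 : C 1. Proof. by case: C_subring => /set_mem. Qed.
Let CB x y : C x -> C y -> C (x - y).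
Proof. by case: C_subring => _ h _ /mem_set Cx /mem_set Cy; exact/set_mem/h. Qed.
Let CM x y : C x -> C y -> C (x * y).
Proof. by case: C_subring => _ _ h /mem_set Cx /mem_set Cy; exact/set_mem/h. Qed.
Let C0 : C 0. Proof. by rewrite -(subrr 1); exact: CB. Qed.
Let CD x y : C x -> C y -> C (x + y).
Proof. by move=> Cx Cy; rewrite -[y]opprK; apply: CB => //; rewrite -sub0r;
  exact: CB. Qed.
Let D1 : D 1. Proof. by case: D_subring => /set_mem. Qed.
Let DB x y : D x -> D y -> D (x - y).
Proof. by case: D_subring => _ h _ /mem_set Cx /mem_set Cy; exact/set_mem/h. Qed.
Let DM x y : D x -> D y -> D (x * y).
Proof. by case: D_subring => _ _ h /mem_set Cx /mem_set Cy; exact/set_mem/h. Qed.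
Let D0 : D 0. Proof. by rewrite -(subrr 1); exact: DB. Qed.
Let DD x y : D x -> D y -> D (x + y).
Proof. by move=> Cx Cy; rewrite -[y]opprK; apply: DB => //; rewrite -sub0r;
  exact: DB. Qed.
Let IN x : I x -> I (- x).
Proof. by move=> Ix; rewrite -mulN1r; apply: IM => //; rewrite -sub0r; exact: CB. Qed.
Let I_add x y : I x -> I y -> I (x + y).
Proof. by move=> Ix Iy; rewrite -[y]opprK; apply/IB/IN. Qed.

Let I_prime c d : C c -> C d -> I (c * d) -> ~ I c -> I d.
Proof.
move=> Cc Cd Icd /(I_maxC Cc)[t Ct Itc].
have -> : d = t * (c * d) - d * (t * c - 1) by ring.
by apply: IB; exact: IM.
Qed.

Section Prime.
Variable Q : set F.
Hypothesis Q_prime : prime_ideal C Q.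
Local Notation q := (Q `&` D).

Let QC : Q `<=` C. Proof. by case: Q_prime. Qed.
Let Q0 : Q 0. Proof. by case: Q_prime => _ []. Qed.
Let QD x y : Q x -> Q y -> Q (x + y).
Proof. by case: Q_prime => _ [_ h _] _ _; exact: h. Qed.
Let QMl c x : C c -> Q x -> Q (c * x).
Proof. by case: Q_prime => _ [_ _ h] _ _; exact: h. Qed.
Let Q1 : ~ Q 1. Proof. by case: Q_prime. Qed.
Let QM x y : C x -> C y -> Q (x * y) -> Q x \/ Q y.
Proof. by case: Q_prime => _ _ _ h; exact: h. Qed.

(* Hence [loc C Q] is already the localization at the denominators in [D]. *)
Let D_denominator s : C s -> ~ Q s -> exists2 t, C t & D (t * s) /\ ~ Q (t * s).
Proof.
(* If [I] lies in [Q], then [s] is not in [I], and an inverse [t] of [s] modulo [I] gives [t * s] in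
   [1 + I], which lies in [D] and misses [Q]. Otherwise an [m] in [I] outside [Q] serves as
   multiplier, since [I] absorbs [C]. *)
move=> Cs Qs; have [IQ|] := pselect (I `<=` Q).
  have [|t Ct Its] := I_maxC Cs; first by move/IQ.
  exists t => //; split; last first.
    move=> Qts; apply: Q1.
    have -> : 1 = t * s + (- 1) * (t * s - 1) by ring.
    by apply: QD => //; apply: QMl (IQ _ Its); rewrite -sub0r; exact: CB.
  by rewrite -(subrK 1 (t * s)); apply: DD => //; exact: ID.
move=> /existsNP[m /not_implyP[Im Qm]]; exists m; first exact/DC/ID.
split; first by rewrite mulrC; apply/ID/IM.
by case/QM => //; exact/DC/ID.
Qed.

Let locP y : loc C Q y ->
  exists c s, [/\ C c, D s, ~ Q s, s != 0 & y = c / s].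
Proof.
move=> [c [s [Cc Cs Qs ->]]]; have [t Ct [Dts Qts]] := D_denominator Cs Qs.
have ts0 : t * s != 0 by apply: contra_notN Qts => /eqP ->.
have [t0 s0] : t != 0 /\ s != 0.
  by split; apply: contraNneq ts0 => ->; rewrite ?mulr0 ?mul0r.
exists (t * c), (t * s); split => //; first exact: CM.
by field; rewrite t0 s0.
Qed.

Let loc_frac c s : C c -> D s -> ~ Q s -> loc C Q (c / s).
Proof. by move=> *; exists c, s; split => //; exact: DC. Qed.

Local Notation E := (loc D q).

Let loc_fracD d s : D d -> D s -> ~ Q s -> E (d / s).
Proof. by move=> *; exists d, s; split => // -[]. Qed.

Let D_E d : D d -> E d.
Proof. by move=> Dd; rewrite -[d]divr1; exact: loc_fracD. Qed.

Let E_loc : E `<=` loc C Q.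
Proof.
move=> _ [d [s [Dd Ds qs ->]]]; apply: loc_frac => //; first exact: DC.
by move=> Qs; apply: qs.
Qed.

Let EP y : E y -> exists d s, [/\ D d, D s, ~ Q s, s != 0 & y = d / s].
Proof.
move=> [d [s [Dd Ds qs ->]]].
have Qs : ~ Q s by move=> Qs; apply: qs.
by exists d, s; split => //; apply: contra_notN Qs => /eqP ->.
Qed.

Let Q_mul s t : D s -> D t -> ~ Q s -> ~ Q t -> ~ Q (s * t).
Proof. by move=> Ds Dt Qs Qt /QM[] //; exact: DC. Qed.

Section PrimeOfLocalization.
Variable P : set F.
Hypothesis P_prime : prime_ideal E P.

Let PE : P `<=` E. Proof. by case: P_prime. Qed.
Let P0 : P 0. Proof. by case: P_prime => _ []. Qed.
Let PD x y : P x -> P y -> P (x + y).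
Proof. by case: P_prime => _ [_ h _] _ _; exact: h. Qed.
Let PMl c x : E c -> P x -> P (c * x).
Proof. by case: P_prime => _ [_ _ h] _ _; exact: h. Qed.
Let P1 : ~ P 1. Proof. by case: P_prime. Qed.
Let PM x y : E x -> E y -> P (x * y) -> P x \/ P y.
Proof. by case: P_prime => _ _ _ h; exact: h. Qed.

Let I_loc m y : I m -> loc C Q y -> E (m * y).
Proof.
move=> Im /locP[c [s [Cc Ds Qs _ ->]]].
by rewrite mulrCA mulrA; apply: loc_fracD => //; apply/ID/IM.
Qed.

Let lift_not_sub : ~ I `<=` P ->
  exists2 P', prime_ideal (loc C Q) P' & P' `&` E = P.
Proof.
move=> /existsNP[m0 /not_implyP[Im0 Pm0]].
exists [set y | loc C Q y /\ forall m, I m -> P (m * y)]; last first.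
  (* For [y] in [E], primality of [P] cancels [m0], which is outside [P], from [m0 * y]. *)
  apply/seteqP; split=> [y [[_ Py] Ey]|y Py].
    by have [] := PM (D_E (ID Im0)) Ey (Py _ Im0).
  split; last exact: PE.
  split; first exact/E_loc/PE.
  by move=> m Im; apply: PMl => //; apply/D_E/ID.
split=> [y []//||[_ /(_ _ Im0)]|].
- split.
  + split=> [|m Im]; last by rewrite mulr0.
    by rewrite -(mul0r (1^-1)); exact: loc_frac.
  + move=> x y [/locP[c [s [Cc Ds Qs s0 ->]]] Px].
    move=> [/locP[d [t [Cd Dt Qt t0 ->]]] Py].
    split=> [|m Im]; last by rewrite mulrDr; apply: PD; auto.
    have -> : c / s + d / t = (c * t + d * s) / (s * t).
      by field; rewrite t0 s0.
    apply: loc_frac; [|exact: DM|exact: Q_mul].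
    by apply: CD; apply: CM => //; exact: DC.
  + move=> l y Ll [/[dup] Ly /locP[d [t [Cd Dt Qt t0 ey]]] Py].
    have [c [s [Cc Ds Qs s0 ->]]] := locP Ll.
    split=> [|m Im].
      have -> : c / s * y = (c * d) / (s * t) by rewrite ey; field; rewrite t0 s0.
      by apply: loc_frac; [exact: CM|exact: DM|exact: Q_mul].
    (* The numerator [c] need not lie in [D], so it is absorbed into [I]; only [1 / s] acts as a
       scalar from [E]. *)
    have -> : m * (c / s * y) = 1 / s * ((c * m) * y) by field.
    by apply: PMl; [exact: loc_fracD|exact/Py/IM].
- by rewrite mulr1.
(* Primality is tested in [E]: if [m * x] and [n * y] are outside [P] for some [m], [n] in [I], both
   still lie in [E], while their product is a multiple of [n * (x * y)], which is in [P]. *)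
move=> x y Lx Ly [_ Pxy]; apply: contrapT => /not_orP[Px Py].
have {Px} [m Im Pmx] : exists2 m, I m & ~ P (m * x).
  apply: contrapT => h; apply: Px; split=> // m Im.
  by apply: contrapT => Pmx; apply: h; exists m.
have {Py} [n In Pny] : exists2 n, I n & ~ P (n * y).
  apply: contrapT => h; apply: Py; split=> // n In.
  by apply: contrapT => Pny; apply: h; exists n.
have [|//|//] := PM (I_loc Im Lx) (I_loc In Ly).
have -> : m * x * (n * y) = m * (n * (x * y)) by ring.
by apply: PMl; [exact/D_E/ID|exact: Pxy].
Qed.

Let lift_sub : I `<=` P ->
  exists2 P', prime_ideal (loc C Q) P' & P' `&` E = P.
Proof.
move=> IP.
(* An element of [I] outside [Q] would be a unit of [E] lying in [P]. *)
have IQ : I `<=` Q.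
  move=> m /[dup] Im /IP Pm; apply: contrapT => Qm; apply: P1.
  have m0 : m != 0 by apply: contra_notN Qm => /eqP ->.
  have -> : 1 = 1 / m * m by field.
  by apply: PMl => //; apply: loc_fracD => //; exact: ID.
(* Maximality of [I] in [D] leaves no room for the proper ideal [P] to meet [D] in more than [I]. *)
have PI d : D d -> P d -> I d.
  move=> Dd Pd; apply: contrapT => /(I_maxD Dd)[t Dt Itd]; apply: P1.
  have -> : 1 = t * d + (- 1) * (t * d - 1) by ring.
  apply: PD; apply: PMl; [exact: D_E| |apply: D_E|exact: IP] => //.
  by rewrite -sub0r; exact: DB.
(* This set is the extension of [I] to [loc C Q], written with denominators from [D]. *)
exists [set y | exists c s, [/\ I c, D s, ~ Q s, s != 0 & y = c / s]]; last first.
  apply/seteqP; split=> [_ [[c [s [Ic Ds Qs s0 ->]]] Ey]|y Py].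
    rewrite mulrC -[s^-1]mul1r.
    by apply: PMl; [exact: loc_fracD|exact: IP].
  have [d [s [Dd Ds Qs s0 e]]] := EP (PE Py).
  split; last exact: PE.
  exists d, s; split=> //; apply: PI => //.
  have -> : d = s * y by rewrite e; field.
  by apply: PMl => //; exact: D_E.
split=> [_ [c [s [Ic Ds Qs s0 ->]]]||[c [s [Ic Ds Qs s0 e]]]|].
- by apply: loc_frac => //; exact/DC/ID.
- split.
  (* That [I] contains 0 comes from exhibiting one element: 1 is not in [Q], hence not in [I], so
     maximality yields [t * 1 - 1] in [I]. *)
  + have [|t Ct It] := I_maxC C1; first by move/IQ.
    exists 0, 1; split=> //; [|exact: oner_neq0|by rewrite mul0r].
    by rewrite -(subrr (t * 1 - 1)); exact: IB.
  + move=> _ _ [c [s [Ic Ds Qs s0 ->]]] [d [t [Id Dt Qt t0 ->]]].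
    exists (t * c + s * d), (s * t); split.
    * by apply: I_add; apply: IM => //; exact: DC.
    * exact: DM.
    * exact: Q_mul.
    * by rewrite mulf_neq0.
    * by field; rewrite s0 t0.
  + move=> _ _ /locP[d [t [Cd Dt Qt t0 ->]]] [c [s [Ic Ds Qs s0 ->]]].
    exists (d * c), (t * s); split.
    * exact: IM.
    * exact: DM.
    * exact: Q_mul.
    * by rewrite mulf_neq0.
    * by field; rewrite s0 t0.
- by apply: Qs; have -> : s = c; [rewrite -[s]mul1r e; field|exact: IQ].
move=> _ _ /locP[c [s [Cc Ds Qs s0 ->]]] /locP[d [t [Cd Dt Qt t0 ->]]].
move=> [n [u [In Du Qu u0 e]]].
(* Clear denominators. The leftover factor [u] is outside [Q], hence outside [I], and [I] is prime
   in [C], so [c] or [d] lies in [I]. *)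
have Iucd : I (u * (c * d)).
  have -> : u * (c * d) = (s * t) * n.
    have -> : n = u * (c / s * (d / t)) by rewrite e; field.
    by field; rewrite s0 t0.
  by apply: IM => //; exact/DC/DM.
have Icd : I (c * d) by apply: (I_prime (DC Du) (CM Cc Cd) Iucd) => /IQ.
have [Ic|nIc] := pselect (I c); first by left; exists c, s.
by right; exists d, t; split => //; exact: I_prime Icd nIc.
Qed.

Lemma shared_ideal_lift : exists2 P', prime_ideal (loc C Q) P' & P' `&` E = P.
Proof. by have [/lift_sub|/lift_not_sub] := pselect (I `<=` P). Qed.

End PrimeOfLocalization.
End Prime.

Lemma shared_ideal_going_down : going_down D C.
Proof. by move=> Q Qpr P Ppr; exact: shared_ideal_lift. Qed.

End SharedMaximalIdeal.

(** * Quotient modules *)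

Section QuotientModule.
Variables (R : nzRingType) (V : lmodType R) (S : {pred V}).

(** Indexing the predicate by its closure proof lets the submodule structure be inferred from the
    term, for any [S] with such a proof. *)
Definition submod_pred of submod_closed S : {pred V} := S.

Hypothesis S_submod : submod_closed S.
Local Notation sS := (submod_pred S_submod).

HB.instance Definition _ := GRing.isSubmodClosed.Build R V sS S_submod.

Definition quot_mod := {ideal_quot sS}.

HB.instance Definition _ := GRing.Zmodule.on quot_mod.
HB.instance Definition _ := EqQuotient.on quot_mod.

Definition quot_pi (v : V) : quot_mod := \pi_quot_mod v.

Lemma quot_piP u v : reflect (quot_pi u = quot_pi v) (u - v \in S).
Proof. by rewrite -[_ \in S]/(u - v \in sS) Quotient.idealrBE; exact: eqP. Qed.

Lemma quot_pi0 : quot_pi 0 = 0.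
Proof. exact: (raddf0 \pi_({ideal_quot sS})). Qed.

Lemma quot_piD : {morph quot_pi : u v / u + v}.
Proof. exact: (raddfD \pi_({ideal_quot sS})). Qed.

Lemma quot_pi_repr u : quot_pi (repr u) = u.
Proof. exact: reprK. Qed.

Lemma repr_quot_pi v : repr (quot_pi v) - v \in S.
Proof. by apply/quot_piP; exact: quot_pi_repr. Qed.

Definition quot_scale (a : R) (u : quot_mod) : quot_mod := quot_pi (a *: repr u).

Lemma quot_scale_pi a v : quot_scale a (quot_pi v) = quot_pi (a *: v).
Proof. by apply/quot_piP; rewrite -scalerBr (rpredZ a (repr_quot_pi v : _ \in sS)). Qed.

Lemma quot_scaleA a b u : quot_scale a (quot_scale b u) = quot_scale (a * b) u.
Proof. by rewrite -[u]quot_pi_repr !quot_scale_pi scalerA. Qed.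

Lemma quot_scale1 : left_id 1 quot_scale.
Proof. by move=> u; rewrite -[u]quot_pi_repr quot_scale_pi scale1r. Qed.

Lemma quot_scaleDr : right_distributive quot_scale +%R.
Proof.
move=> a u v; rewrite -[u]quot_pi_repr -[v]quot_pi_repr.
by rewrite -quot_piD !quot_scale_pi -quot_piD scalerDr.
Qed.

Lemma quot_scaleDl u : {morph quot_scale^~ u : a b / a + b}.
Proof.
by move=> a b; rewrite -[u]quot_pi_repr !quot_scale_pi -quot_piD scalerDl.
Qed.

HB.instance Definition _ := GRing.Zmodule_isLmodule.Build R quot_mod
  quot_scaleA quot_scale1 quot_scaleDr quot_scaleDl.

Lemma quot_piZ a v : quot_pi (a *: v) = a *: quot_pi v.
Proof. by rewrite -quot_scale_pi. Qed.

End QuotientModule.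

(** * Linear maps induced on quotient modules *)

Section QuotientMap.
Variables (R : nzRingType) (V W : lmodType R) (g : {linear V -> W}).
Variables (S : {pred V}) (T : {pred W}).
Hypotheses (S_submod : submod_closed S) (T_submod : submod_closed T).
Hypothesis gST : forall v, (g v \in T) = (v \in S).

(** [S] is the full preimage of [T]: one inclusion makes the induced map well defined, the other
    makes it injective. *)
Definition quot_map of (forall v, (g v \in T) = (v \in S)) :=
  fun u : quot_mod S_submod => quot_pi T_submod (g (repr u)).

Lemma quot_map_pi v : quot_map gST (quot_pi S_submod v) = quot_pi T_submod (g v).
Proof. by apply/quot_piP; rewrite -raddfB gST repr_quot_pi. Qed.

Lemma quot_map_linear : linear (quot_map gST).
Proof.
move=> a u v; rewrite -[u]quot_pi_repr -[v]quot_pi_repr.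
by rewrite -quot_piZ -quot_piD !quot_map_pi linearP quot_piD quot_piZ.
Qed.

HB.instance Definition _ := GRing.isLinear.Build R
  (quot_mod S_submod) (quot_mod T_submod) *:%R (quot_map gST) quot_map_linear.

Lemma quot_map_inj : injective (quot_map gST).
Proof.
move=> u v; rewrite -[u]quot_pi_repr -[v]quot_pi_repr !quot_map_pi.
by move=> /quot_piP; rewrite -raddfB gST => /quot_piP.
Qed.

End QuotientMap.

(** * Conductors of elements of a flat overring *)

Section FlatOverring.
Variable A : idomainType.
Local Notation F := {fraction A}.
Local Notation "x %:F" := (@FracField.tofrac A x).

(** An alias of the fraction field that carries its [A]-module structure. *)
Definition fraction_mod := F.
HB.instance Definition _ := GRing.Zmodule.on fraction_mod.

Definition fraction_scale (a : A) (y : fraction_mod) : fraction_mod :=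
  a%:F * (y : F).

Lemma fraction_scaleA a b y :
  fraction_scale a (fraction_scale b y) = fraction_scale (a * b) y.
Proof. by rewrite /fraction_scale tofracM mulrA. Qed.

Lemma fraction_scale1 : left_id 1 fraction_scale.
Proof. by move=> y; rewrite /fraction_scale tofrac1 mul1r. Qed.

Lemma fraction_scaleDr : right_distributive fraction_scale +%R.
Proof. by move=> a y z; exact: mulrDr. Qed.

Lemma fraction_scaleDl y : {morph fraction_scale^~ y : a b / a + b}.
Proof. by move=> a b; rewrite /fraction_scale tofracD mulrDl. Qed.

HB.instance Definition _ := GRing.Zmodule_isLmodule.Build A fraction_mod
  fraction_scaleA fraction_scale1 fraction_scaleDr fraction_scaleDl.

(** The copy of [A] inside its fraction field, not an integral closure; the quotient by it is
    [F / A]. *)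
Definition integral_pred : {pred fraction_mod} :=
  [pred y : F | `[< exists a : A, y = a%:F >]].

Lemma integral_submod : submod_closed integral_pred.
Proof.
split=> [|a u v /asboolP[b ->] /asboolP[c ->]]; apply/asboolP.
  by exists 0; rewrite tofrac0.
by exists (a * b + c); rewrite tofracD tofracM.
Qed.

Lemma fraction_numden (x : F) : exists a s : A, s != 0 /\ x = a%:F / s%:F.
Proof.
elim/quotW: x => r; exists \n_r, \d_r; rewrite denom_ratioP; split=> //.
have dF0 : (\d_r)%:F != 0 by rewrite tofrac_eq0 denom_ratioP.
(* After moving the denominator across, the equality is cross-multiplication of ratio
   representatives. *)
apply: (canRL (mulfK dF0)); unlock FracField.tofrac.
rewrite -[LHS]FracField.pi_mul; apply/eqmodP.
rewrite /= FracField.equivfE /FracField.mulf !numden_Ratio;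
  rewrite ?mulf_neq0 ?oner_neq0 ?denom_ratioP //.
by rewrite !mulr1 mulrC.
Qed.

Section Conductor.
Variable x : F.

Definition mul_fraction (a : A^o) : fraction_mod := a *: (x : fraction_mod).

Lemma mul_fraction_linear : linear mul_fraction.
Proof. by move=> a u v; rewrite /mul_fraction scalerDl scalerA. Qed.

HB.instance Definition _ := GRing.isLinear.Build A A^o fraction_mod
  *:%R mul_fraction mul_fraction_linear.

(** The conductor [(A : x)], taken as the preimage of [A] under multiplication by [x], so that
    [A / (A : x)] embeds in [F / A] by [quot_map_inj]. *)
Definition conductor_pred : {pred A^o} :=
  [pred a | mul_fraction a \in integral_pred].

Lemma conductor_submod : submod_closed conductor_pred.
Proof.
have [T0 TZ] := integral_submod.
split=> [|a u v xu xv]; last first.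
  by rewrite -[_ \in _]/(mul_fraction (a *: u + v) \in _) linearP; exact: TZ.
by rewrite -[_ \in _]/(mul_fraction 0 \in _) raddf0.
Qed.

Lemma mul_fraction_integral a :
  (mul_fraction a \in integral_pred) = (a \in conductor_pred).
Proof. by []. Qed.

Variable C : overring A.
Hypothesis x_in : overring_set C x.

Section Evaluation.
Variable J : set F.
Hypotheses (J0 : J 0) (JD : forall y z, J y -> J z -> J (y + z)).
Hypothesis JM : forall c y, overring_set C c -> J y -> J (c * y).
Hypothesis conductorJ : forall a : A, a \in conductor_pred -> J a%:F.

Let JN y : J y -> J (- y).
Proof.
have CN1 : - 1 \in overring_pred C by exact: rpredN1.
by move=> Jy; rewrite -mulN1r; apply: JM => //; exact/set_mem/CN1.
Qed.

(** A lift to [F] of the multiplication map from the tensor product of [A / (A : x)] and [C] to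
    [C / J]; because of the chosen representatives, its value is meaningful only modulo [J]. *)
Definition quot_tensor_eval
    (s : seq (quot_mod conductor_submod * overring_mod C)) : F :=
  \sum_(p <- s) (repr p.1)%:F * val p.2.

(** [repr] respects zero, sums and scalars only up to the conductor, and the resulting errors,
    conductor elements times elements of [C], lie in [J]. The remaining relations are formal. *)
Lemma tensor_eq_eval s t : tensor_eq s t ->
  J (quot_tensor_eval s - quot_tensor_eval t).
Proof.
have JK y z : J (y - z) -> J (z - y) by move/JN; rewrite opprB.
have Jn c (n : A) : n \in conductor_pred -> J (n%:F * val (c : overring_mod C)).
  move=> xn; rewrite mulrC; apply: JM; last exact: conductorJ.
  exact/set_mem/(valP c).
rewrite /quot_tensor_eval.
elim=> {s t} [s|s t _|s t u _ H _ H'|s s' t t' _ H _ H'|s t|c|n n' c|n c c'|a n c];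
  rewrite ?big_cat ?big_cons ?big_nil ?addr0 /=.
- by rewrite subrr.
- exact: JK.
- by have := JD H H'; rewrite addrA subrK.
- by have := JD H H'; rewrite opprD addrACA.
- by rewrite addrC subrr.
- rewrite subr0; apply: Jn.
  by have := repr_quot_pi conductor_submod 0; rewrite quot_pi0 subr0.
- rewrite -mulrDl -mulrBl -tofracD -tofracB; apply: Jn.
  have := repr_quot_pi conductor_submod (repr n + repr n').
  by rewrite quot_piD !quot_pi_repr.
- by rewrite mulrDr subrr.
- rewrite mulrA [_ * a%:F]mulrC -mulrBl -tofracM -tofracB; apply: Jn.
  exact: (repr_quot_pi conductor_submod ((a : A) *: repr n)).

Qed.

(* In [(F / A) (x) C] the class of [x = a / s] tensored with [1] is
   [(1 / s) (x) a = (1 / s) (x) s x = 1 (x) x = 0]; flatness pulls this back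
   along the injection [A / (A : x) -> F / A] sending [1] to the class of [x],
   so [1 (x) 1] vanishes in [A / (A : x) (x) C = C / (A : x) C]. *)
Lemma flat_conductor : flat (overring_mod C) -> J 1.
Proof.
have C1 : 1 \in overring_pred C by exact: rpred1.
have xC : x \in overring_pred C by exact/mem_set.
pose uC : overring_mod C := Sub 1 C1.
pose vC : overring_mod C := Sub x xC.
pose f : {linear quot_mod conductor_submod -> quot_mod integral_submod} :=
  quot_map integral_submod mul_fraction_integral.
have f_inj : injective f by exact: quot_map_inj.
move=> /(_ _ _ f f_inj [:: (quot_pi conductor_submod 1, uC)] [::]) /=.
have [a [s [s0 e]]] := fraction_numden x.
have sF0 : s%:F != 0 by rewrite tofrac_eq0.
pose w : quot_mod integral_submod := quot_pi integral_submod (s%:F^-1).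
have -> : f (quot_pi conductor_submod 1) = a *: w.
  rewrite /f /= quot_map_pi -quot_piZ; congr quot_pi.
  by rewrite /= /mul_fraction scale1r.
have asC : a *: uC = s *: vC.
  by apply: val_inj; rewrite !SubK mulr1 e; field.
have sw : s *: w = 0.
  rewrite -quot_piZ -quot_pi0; apply/quot_piP; rewrite subr0.
  by apply/asboolP; exists 1; rewrite tofrac1; exact: mulfV.
have /[swap] /[apply] : tensor_eq [:: (a *: w, uC)] [::].
  apply: tensor_trans (tensor_Z _ _ _) _; rewrite asC.
  by apply: tensor_trans (tensor_sym (tensor_Z _ _ _)) _; rewrite sw;
    exact: tensor_0l.
move/tensor_eq_eval; rewrite /quot_tensor_eval big_seq1 big_nil subr0 /= mulr1 => J1.
(* Evaluation sees a representative [r] of the class of 1, giving [r] in [J]; since [r - 1] is in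
   the conductor, [1 = r - (r - 1)] is in [J] too. *)
set r := repr _ in J1.
have {1}-> : 1 = r%:F - (r - 1)%:F by rewrite tofracB tofrac1; ring.
by apply/JD/JN/conductorJ => //;
  exact: (repr_quot_pi conductor_submod (1 : A^o)).
Qed.

End Evaluation.
End Conductor.
End FlatOverring.

(** * The pullback and its overring [B] *)

Section PullbackOverring.
Variables (B : idomainType) (M : maximal_idealr B).
Variable K : divringClosed {ideal_quot M}.
Local Notation A := (pullback K).
Local Notation F := {fraction A}.
Local Notation "x %:F" := (@FracField.tofrac A x).
Local Notation pi := (\pi_({ideal_quot M})).

Lemma pi_eq0 b : (pi b == 0) = (b \in M).
Proof. by rewrite -(rmorph0 pi) -Quotient.idealrBE subr0. Qed.

Lemma pi_eq b c : (pi b == pi c) = (b - c \in M).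
Proof. by rewrite -pi_eq0 rmorphB subr_eq0. Qed.

Lemma ideal_pullback b : b \in M -> b \in pullback_pred K.
Proof. by rewrite -pi_eq0 => /eqP b0; rewrite inE b0 rpred0. Qed.

Lemma maximal_inverse b : b \notin M -> exists c, c * b - 1 \in M.
Proof.
rewrite -pi_eq0 => b0; exists (repr ((pi b)^-1 : {ideal_quot M})).
by rewrite -pi_eq rmorphM rmorph1 [X in X * _]reprK mulVf.
Qed.

(** Since [K] is closed under inverses, any lift of the inverse residue class falls in the pullback;
    thus [M] is maximal there too. *)
Lemma pullback_inverse b : b \in pullback_pred K -> b \notin M ->
  exists2 c, c \in pullback_pred K & c * b - 1 \in M.
Proof.
rewrite inE -pi_eq0 => bK b0; exists (repr ((pi b)^-1 : {ideal_quot M})).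
  by rewrite inE reprK rpredV.
by rewrite -pi_eq rmorphM rmorph1 [X in X * _]reprK mulVf.
Qed.

Variable m : B.
Hypotheses (mM : m \in M) (m0 : m != 0).

Let idealA b : b \in M -> A := fun bM => Sub b (ideal_pullback bM).

Let mulM b : b * m \in M.
Proof. exact: idealMr. Qed.

Definition pullback_embed (b : B) : F :=
  (idealA (mulM b))%:F / (idealA mM)%:F.
Local Notation phi := pullback_embed.

Let mF0 : (idealA mM)%:F != 0.
Proof. by rewrite tofrac_eq0 -val_eqE /= m0. Qed.

Lemma pullback_embed_val (a : A) : phi (val a) = a%:F.
Proof.
apply: (canLR (mulfK mF0)); rewrite -tofracM; congr _%:F.
by apply: val_inj; rewrite SubK rmorphM.
Qed.

Lemma pullback_embedB : {morph phi : b c / b - c}.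
Proof.
move=> b c; rewrite /phi -mulrBl -tofracB; congr (_%:F / _).
by apply: val_inj; rewrite rmorphB !SubK mulrBl.
Qed.

Lemma pullback_embedM : {morph phi : b c / b * c}.
Proof.
move=> b c; rewrite /phi mulf_div; apply/eqP; rewrite eqr_div ?mulf_neq0 //.
apply/eqP; rewrite -!tofracM; congr _%:F.
by apply: val_inj; rewrite !rmorphM /=; ring.
Qed.

Lemma pullback_embed1 : phi 1 = 1.
Proof. by rewrite -(tofrac1 A) -pullback_embed_val rmorph1. Qed.

Lemma pullback_embed_inj : injective phi.
Proof.
move=> b c /(divIf mF0)/eqP; rewrite tofrac_eq -val_eqE !SubK => /eqP.
exact: mulIf.
Qed.

Lemma pullback_embed_subring : subring_closed (mem (range phi)).
Proof.
split=> [|_ _ /set_mem[b _ <-] /set_mem[c _ <-]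
  |_ _ /set_mem[b _ <-] /set_mem[c _ <-]].
- by apply/mem_set; exists 1 => //; exact: pullback_embed1.
- by apply/mem_set; exists (b - c) => //; exact: pullback_embedB.
- by apply/mem_set; exists (b * c) => //; exact: pullback_embedM.
Qed.

Lemma pullback_embed_incl (a : A) : a%:F \in range phi.
Proof. by apply/mem_set; exists (val a) => //; exact: pullback_embed_val. Qed.

Definition pullback_overring : overring A :=
  Overring pullback_embed_subring pullback_embed_incl.

Let I : set F := [set y | exists2 b, b \in M & phi b = y].

Let IE b : I (phi b) -> b \in M.
Proof. by move=> [c cM /pullback_embed_inj <-]. Qed.

Lemma pullback_going_down :
  going_down (range (@FracField.tofrac A)) pullback_overring.
Proof.
(* Here the larger ring is the image of [B], the smaller one that of [A], and [I] is the image of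
   [M]. *)
apply: (@shared_ideal_going_down _ _ _ I).
- exact: pullback_embed_subring.
- split=> [|_ _ /set_mem[b _ <-] /set_mem[c _ <-]
  |_ _ /set_mem[b _ <-] /set_mem[c _ <-]].
  + by apply/mem_set; exists 1 => //; exact: tofrac1.
  + by apply/mem_set; exists (b - c) => //; exact: tofracB.
  + by apply/mem_set; exists (b * c) => //; exact: tofracM.
- by move=> _ [a _ <-]; exact/set_mem/pullback_embed_incl.
- by move=> _ [b bM <-]; exists (idealA bM) => //; rewrite -pullback_embed_val SubK.
- by move=> _ _ [b bM <-] [c cM <-]; exists (b - c); rewrite ?rpredB ?pullback_embedB.
- move=> _ _ [b _ <-] [c cM <-].
  by exists (b * c); [exact: idealMr|exact: pullback_embedM].
- move=> _ [b _ <-] nb.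
  have [|c cb] := @maximal_inverse b; first by apply/negP => bM; apply: nb; exists b.
  exists (phi c); first by exists c.
  by exists (c * b - 1); rewrite // pullback_embedB pullback_embedM pullback_embed1.
(* Maximality of [M] in [A]: the inverse modulo [M] has to be found inside [A]. *)
move=> _ [a _ <-] na.
have [||c cA ca] := @pullback_inverse (val a); first exact: valP.
  by apply/negP => aM; apply: na; exists (val a); rewrite ?pullback_embed_val.
exists (Sub c cA : A)%:F; first by exists (Sub c cA).
exists (c * val a - 1) => //.
by rewrite pullback_embedB pullback_embedM pullback_embed1 -!pullback_embed_val SubK.
Qed.

Lemma pullback_not_flat x : x \notin K -> ~ flat (overring_mod pullback_overring).
Proof.
move=> xK flatB.
suff /IE : I (phi 1) by rewrite idealr1.
(* A lift of [x] lies in [B] but not in [A]; the ideal [J] is the image of [M], so 1 would lie in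
   [M]. *)
rewrite pullback_embed1; apply: (@flat_conductor _ (phi (repr x)) _ _ _ _ _ _ _ flatB).
- by exists (repr x).
- by exists 0; [exact: rpred0|rewrite -(subrr 1) pullback_embedB subrr].
- move=> _ _ [b bM <-] [c cM <-]; exists (b - - c); first by rewrite !(rpredB, rpredN).
  by rewrite -[- c]sub0r !pullback_embedB -(subrr 1) pullback_embedB; ring.
- move=> _ _ [b _ <-] [c cM <-].
  by exists (b * c); [exact: idealMr|exact: pullback_embedM].
move=> a /asboolP[c].
have -> : mul_fraction (phi (repr x)) a = phi (val a * repr x).
  by rewrite pullback_embedM pullback_embed_val.
rewrite -!pullback_embed_val.
move=> /pullback_embed_inj ac; exists (val a) => //.
(* If [a] were outside [M], its class would be a nonzero element of [K] whose product with [x] is in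
   [K], forcing [x] into [K]. *)
apply: contraNT xK; rewrite -pi_eq0 => a0.
have := valP c; rewrite -ac inE rmorphM [X in _ * X]reprK => axK.
by rewrite -[x](mulKf a0) rpredM ?rpredV //; exact: valP a.
Qed.

End PullbackOverring.

(** If [M] were zero, [B] would be a field and the pullback a copy of the field [K], which is
    perinormal; a nonzero element of [M] is what places [B] inside the fraction field of the
    pullback. *)
Theorem theorem11 (B : idomainType) (M : maximal_idealr B)
    (M_neq0 : exists2 m : B, m \in M & m != 0%R)
    (K : divringClosed {ideal_quot M})
    (K_proper : exists x : {ideal_quot M}, x \notin K) :
  ~ perinormal (pullback K).
Proof.
have [m mM m0] := M_neq0; have [x xK] := K_proper.
move=> /(_ _ (@pullback_going_down _ _ K _ mM m0)).
exact: pullback_not_flat xK.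
Qed.
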